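(* Let $V\cong\mathbb Z^n$ and $Z\cong\mathbb Z^m$, let $\beta\colon V\times V\to Z$ be bilinear, and let $\Gamma_\beta=V\times Z$ with multiplication $(x,z)(y,w)=(x+y,\,z+w+\beta(x,y))$. Put $\omega(x,y)=\beta(x,y)-\beta(y,x)$. Let $\phi(x,z)=(Ax,\,Cz+\lambda(x))$, where $A\in\mathrm{End}(V)$, $C\in\mathrm{End}(Z)$ and $\lambda\colon V\to Z$ is a function satisfying $$\lambda(x+y)-\lambda(x)-\lambda(y)=\beta(Ax,Ay)-C\beta(x,y)\qquad(x,y\in V),$$ so that $\phi$ is an endomorphism of $\Gamma_\beta$. Put $B=I-A$, $D=I-C$, and assume $\det B\neq0$ and $\det D\neq0$. Let $$R_D(\omega)=\{p\in V:\omega(V,p)\subseteq DZ\},$$ $$K_\phi=\{(Bp,e):p\in R_D(\omega),\ e\in Z,\ e+\lambda(p)+\beta(Bp,Ap)\in DZ\},$$ $$U_\phi=\{n\in\Gamma_\beta: g\sim_\phi gn\text{ for every }g\in\Gamma_\beta\}.$$ Then $K_\phi=U_\phi$, and this is a normal finite-index subgroup of $\Gamma_\beta$ with $\phi(K_\phi)\subseteq K_\phi$. The quotient $\Gamma_\beta/K_\phi$ separates all $\phi$-Reidemeister classes, and every compatible resolving kernel $N$ satisfies $N\subseteq K_\phi$. Consequently $K_\phi$ is the unique maximal compatible resolving kernel, and $$\mathrm{oc}_R(\phi)=|\det(I-A)|\,|\det(I-C)|\,[V:R_D(\omega)].$$ Furthermore, the number $R(\phi)$ of $\phi$-twisted conjugacy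 classes is $$R(\phi)=|\det(I-A)|\,|\det(I-C)|,\qquad\text{so}\qquad \frac{\mathrm{oc}_R(\phi)}{R(\phi)}=[V:R_D(\omega)].$$
   Context: For an endomorphism $\phi$ of a group $G$, write $a\sim_\phi b$ if $b=ga\phi(g)^{-1}$ for some $g\in G$; the equivalence classes are the $\phi$-twisted conjugacy (Reidemeister) classes, the set of which is $\mathcal R(\phi)$, and $R(\phi)=\#\mathcal R(\phi)$. If $N\triangleleft G$ has $\phi(N)\subseteq N$, let $q_N\colon G\to G/N$ be the quotient map, $\bar\phi_N$ the endomorphism of $G/N$ induced by $\phi$, and $(q_N)_R\colon\mathcal R(\phi)\to\mathcal R(\bar\phi_N)$, $[a]_\phi\mapsto[q_N(a)]_{\bar\phi_N}$. A compatible resolving kernel is a finite-index normal subgroup $N\triangleleft G$ with $\phi(N)\subseteq N$ such that $(q_N)_R$ is injective on $\mathcal R(\phi)$ (i.e. $G/N$ separates all Reidemeister classes). The full Reidemeister resolution degree $\mathrm{oc}_R(\phi)$ is the minimum of $[G:N]$ over all compatible resolving kernels $N$. *)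

(* Defs.v *)
From HB Require Import structures.
From mathcomp Require Import all_boot all_order all_algebra.
From mathcomp Require Import finmap.
From mathcomp Require Import boolp classical_sets functions cardinality.

Set Implicit Arguments.
Unset Strict Implicit.
Unset Printing Implicit Defensive.

Import GRing.Theory.

Local Open Scope classical_set_scope.

(* Cardinal of a finite set; by convention 0 on an infinite set. *)
Definition cardinal (T : choiceType) (S : set T) : nat := #|` fset_set S|%fset.

Section Groups.
Local Open Scope group_scope.
Variable G : groupType.

Record normal_subgroup (N : set G) : Prop := NormalSubgroup {
  normal1 : N 1;
  normalM : forall x y, N x -> N y -> N (x * y);
  normalV : forall x, N x -> N x^-1;
  normalJ : forall g x, N x -> N (g * x * g^-1)
}.

Definition lcosets (N : set G) : set (set G) :=
  range (fun g => [set g * n | n in N]).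

Definition group_index (N : set G) : nat := cardinal (lcosets N).

Section Reidemeister.
Variable phi : G -> G.

Definition twisted_conj (a b : G) : Prop := exists g, b = g * a * (phi g)^-1.

Definition reidemeister_class (a : G) : set G := [set b | twisted_conj a b].

Definition reidemeister_set : set (set G) := range reidemeister_class.

Definition reidemeister_number : nat := cardinal reidemeister_set.

Definition U_phi : set G := [set n | forall g, twisted_conj g (g * n)].

End Reidemeister.

End Groups.

Section Quotient.
Local Open Scope group_scope.
Variables (G : groupType) (N : set G) (nN : normal_subgroup N).

Definition coset_rel : rel G := fun x y => `[< N (x^-1 * y) >].

Lemma coset_rel_equiv : equiv_class_of coset_rel.
Proof.
split=> [x|x y|y x z].
- by apply/asboolP; rewrite mulVg; exact: normal1 nN.
- by apply: asbool_equiv_eq; split=> /(normalV nN); rewrite invgM invgK.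
- move=> /asboolP xy /asboolP yz; apply/asboolP.
  by have := normalM nN xy yz; rewrite mulgA mulgK.
Qed.

Canonical coset_equiv := EquivRelPack coset_rel_equiv.

Definition quotient : Type := {eq_quot coset_equiv}%qT.
HB.instance Definition _ := Choice.on quotient.
HB.instance Definition _ := EqQuotient.on quotient.

Definition quo (g : G) : quotient := (\pi g)%qT.

Lemma quo_eq x y : quo x = quo y <-> N (x^-1 * y).
Proof. by split=> [/eqmodP/asboolP|xy] //; apply/eqmodP/asboolP. Qed.

Lemma quo_repr x : quo (repr x) = x. Proof. exact: reprK. Qed.

Definition quotient_mul (x y : quotient) : quotient := quo (repr x * repr y).
Definition quotient_inv (x : quotient) : quotient := quo (repr x)^-1.

Lemma quoM x y : quotient_mul (quo x) (quo y) = quo (x * y).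
Proof.
apply/quo_eq; rewrite invgM -mulgA.
have /quo_eq xN := quo_repr (quo x); have /quo_eq yN := quo_repr (quo y).
have := normalM nN (normalJ nN (repr (quo y))^-1 xN) yN.
by rewrite invgK !mulgA mulgK.
Qed.

Lemma quoV x : quotient_inv (quo x) = quo x^-1.
Proof.
apply/quo_eq; rewrite invgK; have /quo_eq xN := quo_repr (quo x).
have := normalJ nN x (normalV nN xN).
by rewrite invgM invgK !mulgA mulgV mul1g.
Qed.

Lemma quotient_mulA : associative quotient_mul.
Proof.
move=> x y z; rewrite -(quo_repr x) -(quo_repr y) -(quo_repr z).
by rewrite !quoM mulgA.
Qed.

Lemma quotient_mul1 : left_id (quo 1) quotient_mul.
Proof. by move=> x; rewrite -(quo_repr x) quoM mul1g. Qed.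

Lemma quotient_1mul : right_id (quo 1) quotient_mul.
Proof. by move=> x; rewrite -(quo_repr x) quoM mulg1. Qed.

Lemma quotient_mulV : left_inverse (quo 1) quotient_inv quotient_mul.
Proof. by move=> x; rewrite -(quo_repr x) quoV quoM mulVg. Qed.

Lemma quotient_Vmul : right_inverse (quo 1) quotient_inv quotient_mul.
Proof. by move=> x; rewrite -(quo_repr x) quoV quoM mulgV. Qed.

HB.instance Definition _ := isGroup.Build quotient quotient_mulA
  quotient_mul1 quotient_1mul quotient_mulV quotient_Vmul.

Variable phi : G -> G.

(* Independent of the representative when [phi] is an endomorphism with
   [phi N] contained in [N]: see [induced_quo]. *)
Definition induced (x : quotient) : quotient := quo (phi (repr x)).

(* The union of the classes of [quo a] for [a] in [c]; it is the class of [quo a]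
   when [c] is the class of [a]: see [quo_R_class]. *)
Definition quo_R (c : set G) : set quotient :=
  \bigcup_(a in c) reidemeister_class induced (quo a).

Hypotheses (phiM : {morph phi : x y / x * y}) (phiN : phi @` N `<=` N).

Lemma induced_quo g : induced (quo g) = quo (phi g).
Proof.
have phi1 : phi 1 = 1 by apply: (mulgI (phi 1)); rewrite -phiM !mulg1.
have phiV x : phi x^-1 = (phi x)^-1.
  by apply: (mulgI (phi x)); rewrite -phiM !mulgV phi1.
apply/quo_eq; rewrite -phiV -phiM; apply: phiN.
by exists ((repr (quo g))^-1 * g) => //; apply/quo_eq; exact: quo_repr.
Qed.

Lemma quo_R_class a :
  quo_R (reidemeister_class phi a) = reidemeister_class induced (quo a).
Proof.
have qMg x y : quo (x * y) = quo x * quo y by rewrite -quoM.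
have qVg x : quo x^-1 = (quo x)^-1 by rewrite -quoV.
apply/seteqP; split=> [_ [_ [g ->]] [x ->]|x xa]; last first.
  exists a => //; exists 1.
  have := phiM 1 1; rewrite mulg1 => /esym/eqP; rewrite -{3}(mulg1 (phi 1)).
  by move=> /eqP/mulgI ->; rewrite invg1 mulg1 mul1g.
have [y ->] : exists y, x = quo y by exists (repr x); rewrite quo_repr.
exists (quo y * quo g).
by rewrite -(qMg y g) !induced_quo phiM !qMg !qVg invgM !mulgA.
Qed.

End Quotient.

Arguments quo {G N} nN g.
Arguments induced {G N} nN phi x.
Arguments quo_R {G N} nN phi c _.

Section ResolvingKernel.
Variables (G : groupType) (phi : G -> G).

Definition separates (N : set G) (nN : normal_subgroup N) : Prop :=
  set_inj (reidemeister_set phi) (quo_R nN phi).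

Definition compatible_resolving_kernel (N : set G) : Prop :=
  exists nN : normal_subgroup N,
    [/\ finite_set (lcosets N), phi @` N `<=` N & separates nN].

Definition maximal_resolving_kernel (M : set G) : Prop :=
  compatible_resolving_kernel M /\
  forall N, compatible_resolving_kernel N -> M `<=` N -> N = M.

(* The minimum of the indices; by convention 0 if there is no compatible
   resolving kernel. *)
Definition oc_R : nat :=
  xget 0%N [set k | (exists2 N, compatible_resolving_kernel N & group_index N = k) /\
    forall N, compatible_resolving_kernel N -> (k <= group_index N)%N].

End ResolvingKernel.

Section Heisenberg.
Local Open Scope ring_scope.
Variables n m : nat.
Notation V := 'cV[int]_n.
Notation Z := 'cV[int]_m.

(* [beta] does not occur in the carrier: it only selects the group law. *)
Definition Gamma (beta : {bilinear V -> V -> Z}) : Type := (V * Z)%type.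

Section GammaGroup.
Variable beta : {bilinear V -> V -> Z}.
Notation Gamma := (Gamma beta).

HB.instance Definition _ := Choice.on Gamma.

Definition Gamma_mul (g h : Gamma) : Gamma :=
  (g.1 + h.1, g.2 + h.2 + beta g.1 h.1).
Definition Gamma_one : Gamma := (0, 0).
Definition Gamma_inv (g : Gamma) : Gamma := (- g.1, beta g.1 g.1 - g.2).

Lemma Gamma_mulA : associative Gamma_mul.
Proof.
move=> [x a] [y b] [z c]; rewrite /Gamma_mul /= linearDr linearDl /= !addrA.
congr (_, _); rewrite -!addrA; do 2!congr (_ + _).
by rewrite (addrC (beta y z)) -(addrA (beta x y)); exact: addrCA.
Qed.

Lemma Gamma_mul1g : left_id Gamma_one Gamma_mul.
Proof. by case=> x a; rewrite /Gamma_mul /= linear0l !add0r addr0. Qed.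

Lemma Gamma_mulg1 : right_id Gamma_one Gamma_mul.
Proof. by case=> x a; rewrite /Gamma_mul /= linear0r !addr0. Qed.

Lemma Gamma_mulVg : left_inverse Gamma_one Gamma_inv Gamma_mul.
Proof.
by case=> x a; rewrite /Gamma_mul /= linearNl subrK addNr subrr.
Qed.

Lemma Gamma_mulgV : right_inverse Gamma_one Gamma_inv Gamma_mul.
Proof.
by case=> x a; rewrite /Gamma_mul /= linearNr [a + _]addrCA !subrr addr0 subrr.
Qed.

HB.instance Definition _ := isGroup.Build Gamma Gamma_mulA
  Gamma_mul1g Gamma_mulg1 Gamma_mulVg Gamma_mulgV.

Definition omega (x y : V) : Z := beta x y - beta y x.

Definition Gamma_map (A : 'M[int]_n) (C : 'M[int]_m) (lambda : V -> Z)
  (g : Gamma) : Gamma := (A *m g.1, C *m g.2 + lambda g.1).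

Definition image_lattice (D : 'M[int]_m) : set Z := range (fun z : Z => D *m z).

Definition R_D (D : 'M[int]_m) : set V :=
  [set p | forall x, image_lattice D (omega x p)].

Definition K_phi (A : 'M[int]_n) (C : 'M[int]_m) (lambda : V -> Z) :
    set Gamma :=
  let B := 1%:M - A in let D := 1%:M - C in
  [set g | exists p e, [/\ R_D D p,
     image_lattice D (e + lambda p + beta (B *m p) (A *m p))
     & g = (B *m p, e)]].

End GammaGroup.

(* Index of a subgroup of the additive group [V]; by convention 0 if it is
   infinite. *)
Definition lattice_index (P : set V) : nat :=
  cardinal (range (fun x => [set x + p | p in P])).

End Heisenberg.

Arguments Gamma {n m} beta.
Arguments Gamma_map {n m beta} A C lambda g.
Arguments R_D {n m} beta D _.
Arguments K_phi {n m} beta A C lambda _.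

(* Main.v *)
(* For n in a compatible resolving kernel N, g and gn have the same image in G/N,
   hence are twisted conjugate: so N is contained in U_phi, and U_phi itself is
   a compatible resolving kernel as soon as it is normal of finite index.

   In Gamma_beta, (y, w) is twisted conjugate to (y', w') iff y' - y = Bx and
   w' = w + beta(x, y) - lambda(x) - beta(y', Ax) modulo DZ for some x. As B is
   injective this gives |V/BV| |Z/DZ| classes. It also shows that (Bp, e) lies in
   U_phi iff e + lambda(p) + beta(Bp, Ap) + omega(y, p) is in DZ for all y, that is
   U_phi = K_phi. Since conjugating (q, e) by (x, z) adds omega(x, q) to e,
   normality reduces to A R_D <= R_D. Finally Gamma_beta/K_phi fibres over V/B R_D
   with fibre Z/DZ, and lattice indices come from the Smith normal form. *)

Require Import Defs.
From HB Require Import structures.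
From mathcomp Require Import all_boot all_order all_algebra.
From mathcomp Require Import ring.
From mathcomp Require Import boolp classical_sets functions cardinality.
Set Implicit Arguments.
Unset Strict Implicit.
Unset Printing Implicit Defensive.

Import GRing.Theory.
Local Open Scope classical_set_scope.
Local Open Scope ring_scope.

(** * Counting classes, and indices of integer lattices *)

(* [E] is an equivalence relation with exactly [k] classes: [f] enumerates them. *)
Definition class_number (T : Type) (E : T -> T -> Prop) (k : nat) : Prop :=
  exists2 f : T -> 'I_k,
    forall i, exists x, f x = i & forall x y, f x = f y <-> E x y.

Lemma class_number_fintype (T : Type) (F : finType) (E : T -> T -> Prop)
    (f : T -> F) :
  (forall i, exists x, f x = i) -> (forall x y, f x = f y <-> E x y) ->
  class_number E #|F|.
Proof.
move=> f_surj f_ker; exists (fun x => enum_rank (f x)) => [i|x y].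
  by have [x fx] := f_surj (enum_val i); exists x; rewrite fx enum_valK.
by rewrite -f_ker; split=> [/enum_rank_inj|->].
Qed.

Lemma class_number_finite (T : Type) (F : finType) (E : T -> T -> Prop)
    (f : T -> F) :
  (forall x y, f x = f y <-> E x y) -> exists k, class_number E k.
Proof.
move=> f_ker; pose im (i : F) := `[< exists x, f x = i >].
have im_f x : im (f x) by apply/asboolP; exists x.
pose g x : {i | im i} := exist _ (f x) (im_f x).
exists #|{: {i | im i}}|; apply: (@class_number_fintype _ _ _ g).
  move=> [i im_i]; have /asboolP[x fx] := im_i.
  by exists x; apply: val_inj.
by move=> x y; rewrite -f_ker; split=> [[]|fxy] //; apply: val_inj.
Qed.

(** Turns class counts into cardinals of sets of sets: left cosets, Reidemeister classes and lattice
    translates are all ranges of a map [c] whose fibres are the classes of [E]. *)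
Lemma cardinal_range (T : Type) (T' : choiceType) (E : T -> T -> Prop)
    (c : T -> T') k :
  class_number E k -> (forall x y, c x = c y <-> E x y) ->
  finite_set (range c) /\ cardinal (range c) = k.
Proof.
move=> [f f_surj f_ker] c_ker.
have [s sK] : exists s : 'I_k -> T, cancel s f.
  have [s sK] := choice f_surj; by exists s.
have -> : range c = [set c (s i) | i in [set: 'I_k]].
  apply/seteqP; split=> _ [x _ <-]; last by exists (s x).
  by exists (f x) => //; apply/c_ker/f_ker; rewrite sK.
have fin : finite_set [set c (s i) | i in [set: 'I_k]] by apply: finite_image.
split=> //; apply: card_fset_set => //.
rewrite (card_eqr card_II); apply: inj_card_eq => i j _ _.
by move/c_ker/f_ker; rewrite !sK.
Qed.

(** With [M = L *m Delta *m R] in Smith form and [L], [R] unimodular, the class of [x] modulo the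
    image of [M] is read off from the coordinates of [invmx L *m x] modulo the diagonal entries,
    whose product is the determinant up to sign. *)
Lemma class_number_smith (n : nat) (M : 'M[int]_n) :
  \det M != 0 -> class_number (fun x y => image_lattice M (x - y)) `|\det M|%N.
Proof.
move=> M_neq0; have [L uL [R uR [d _ defM]]] := int_Smith_normal_form M.
set Delta : 'M_n := \matrix_(i, j) _ in defM.
have detM : `|\det M|%N = (\prod_(i < n) `|(d`_i)%R|)%N.
  have abs1 (P : 'M[int]_n) : P \in unitmx -> `|\det P|%N = 1%N.
    by rewrite unitmxE => /orP[]/eqP->.
  have DeltaE : Delta = diag_mx (\row_i (d`_i)%R).
    by apply/matrixP=> i j; rewrite !mxE.
  rewrite defM DeltaE !det_mulmx !abszM (abs1 _ uL) (abs1 _ uR) mul1n muln1 det_diag.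
  rewrite (big_morph absz abszM (erefl : `|1|%N = 1%N)).
  by apply: eq_bigr => i _; rewrite mxE.
have d_neq0 i : (i < n)%N -> d`_i != 0.
  move=> ltin; apply: contraNneq M_neq0 => d0.
  by rewrite -absz_eq0 detM (bigD1 (Ordinal ltin)) //= d0 mul0n.
have imageP v : image_lattice M v <->
    forall i, (d`_i %| (invmx L *m v) i ord0)%Z.
  have DeltaE w i : (Delta *m w) i ord0 = d`_i * w i ord0 :> int.
    rewrite mxE (bigD1 i) //= mxE eqxx mulr1n big1 ?addr0 // => j ji.
    by rewrite mxE [val i == _]eq_sym val_eqE (negPf ji) mulr0n mul0r.
  split=> [[w _ <-] i|dvd].
    by rewrite defM -!mulmxA mulKmx // DeltaE dvdz_mulr.
  pose w : 'cV[int]_n := \col_i ((invmx L *m v) i ord0 %/ d`_i)%Z.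
  exists (invmx R *m w) => //; rewrite defM -!mulmxA mulKVmx //.
  rewrite -[RHS](mulKVmx uL); congr (_ *m _); apply/colP=> i.
  by rewrite DeltaE mxE mulrC divzK.
(* The form [.-1.+1] makes the ordinal type visibly inhabited, as [inord] requires; it changes
   nothing because the diagonal entries are nonzero. *)
pose F := {dffun forall i : 'I_n, 'I_(`|(d`_i)%R|.-1.+1)}.
have cardF : #|F| = `|\det M|%N.
  rewrite card_dep_ffun detM foldrE big_image /=.
  by apply: eq_bigr => i _; rewrite card_ord prednK // absz_gt0 d_neq0.
pose f (x : 'cV[int]_n) : F :=
  [ffun i : 'I_n => inord `|((invmx L *m x) i ord0 %% d`_i)%Z|%N].
have lt_d (i : 'I_n) z : (`|(z %% (d`_i)%R)%Z| < `|(d`_i)%R|.-1.+1)%N.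
  by rewrite prednK ?absz_gt0 ?d_neq0 // -ltz_nat gez0_abs ?modz_ge0 ?ltz_mod ?d_neq0.
rewrite -cardF; apply: (@class_number_fintype _ F _ f).
  move=> g; exists (L *m \col_i (g i : nat)%:Z); apply/ffunP=> i.
  rewrite ffunE mulKmx // mxE; apply: val_inj; rewrite /= inordK //.
  rewrite -modz_abs modz_nat absz_nat modn_small //.
  by rewrite -[X in (_ < X)%N]prednK ?absz_gt0 ?d_neq0.
move=> x y; rewrite imageP.
have modP i : (d`_i %| (invmx L *m (x - y)) i ord0)%Z =
    (((invmx L *m x) i ord0 %% d`_i)%Z == ((invmx L *m y) i ord0 %% d`_i)%Z).
  by rewrite eqz_mod_dvd mulmxBr !mxE.
split=> [fxy i|dvd]; last first.
  by apply/ffunP=> i; rewrite !ffunE; congr (inord `|_|%N); apply/eqP; rewrite -modP.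
have := congr1 (fun g : F => val (g i)) fxy; rewrite /f !ffunE /= !inordK // => abs_eq.
rewrite modP -[X in X == _]gez0_abs ?modz_ge0 ?d_neq0 // abs_eq.
by rewrite gez0_abs ?modz_ge0 ?d_neq0.
Qed.

(** An [E']-class is determined by the set of representatives [s j] of [E]-classes that it contains,
    and there are finitely many such sets. *)
Lemma class_number_coarsen (T : Type) (E E' : T -> T -> Prop) k :
  (forall x, E' x x) -> (forall x y, E' x y -> E' y x) ->
  (forall x y z, E' x y -> E' y z -> E' x z) ->
  (forall x y, E x y -> E' x y) ->
  class_number E k -> exists k', class_number E' k'.
Proof.
move=> E'r E's E't EE' [f /choice[s sK] f_ker].
pose g x := [set j | `[< E' x (s j) >]]%SET.
apply: (@class_number_finite _ _ _ g) => x y; split=> [gxy|xy].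
  have : f y \in g y by rewrite inE; apply/asboolP/EE'/f_ker; rewrite sK.
  have xs : E' y (s (f y)) by apply/EE'/f_ker; rewrite sK.
  by rewrite -gxy inE => /asboolP /E't; apply; apply: E's.
apply/setP=> j; rewrite !inE; apply: asbool_equiv_eq.
by split; apply: E't => //; apply: E's.
Qed.

Lemma class_number_pigeonhole (T : Type) (E : T -> T -> Prop) k (u : nat -> T) :
  class_number E k -> exists i j, (i < j)%N /\ E (u i) (u j).
Proof.
move=> [f _ f_ker]; pose g (i : 'I_k.+1) := f (u i).
have /injectivePn[i [j ij gij]] : ~~ injectiveb g.
  apply/negP=> /injectiveP /leq_card.
  by rewrite !card_ord ltnn.
case: (ltngtP i j) => [lt|lt|/val_inj eq_ij].
- by exists i, j; split=> //; apply/f_ker.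
- by exists j, i; split=> //; apply/f_ker.
- by rewrite eq_ij eqxx in ij.
Qed.

(* The translations [t] move each class into the fibre over a chosen representative
   of the base class, where [E] is congruence modulo [L]. *)
Lemma class_number_fibered (X : Type) (Y : zmodType) (EX : X -> X -> Prop)
    (L : Y -> Prop) (E : X * Y -> X * Y -> Prop) k l :
  class_number EX k -> class_number (fun y y' => L (y - y')) l ->
  (forall g h, E g h -> E h g) -> (forall g h i, E g h -> E h i -> E g i) ->
  (forall x x', EX x x' -> exists t, forall y, E (x, y) (x', y + t)) ->
  (forall x y x' y', E (x, y) (x', y') -> EX x x') ->
  (forall x y y', E (x, y) (x, y') <-> L (y - y')) ->
  class_number E (k * l).
Proof.
move=> [q /choice[s sK] q_ker] [r r_surj r_ker] Es Et tr base fiber.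
have /choice[t tE] x : exists t, forall y, E (x, y) (s (q x), y + t).
  by apply: tr; apply/q_ker; rewrite sK.
pose f (g : X * Y) := (q g.1, r (g.2 + t g.1)).
rewrite -[k]card_ord -[l]card_ord -card_prod.
apply: (@class_number_fintype _ _ _ f) => [[i j]|[x y] [x' y']].
  have [y ry] := r_surj j; exists (s i, y - t (s i)).
  by rewrite /f /= subrK sK ry.
split=> [[qq /r_ker/(fiber (s (q x))) yy]|E12].
  by apply: Et (tE x y) (Et _ _ _ yy _); rewrite qq; apply/Es/tE.
have qq : q x = q x' by apply/q_ker/base/E12.
congr (_, _) => //=; apply/r_ker/(fiber (s (q x))).
by apply: Et (Es _ _ (tE x y)) (Et _ _ _ E12 _); rewrite qq.
Qed.

(** [B] may fail to be invertible over the integers, but its adjugate reduces the claim to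
    cancelling the scalar [\det B]. *)
Lemma det_mulmx_inj (n : nat) (B : 'M[int]_n) (x y : 'cV[int]_n) :
  \det B != 0 -> B *m x = B *m y -> x = y.
Proof.
move=> B0 /(congr1 (mulmx (\adj B))); rewrite !mulmxA mul_adj_mx !mul_scalar_mx.
by move=> xy; apply/colP=> i; have /colP/(_ i) := xy; rewrite !mxE => /(mulfI B0).
Qed.

(** This is [V : BP] = [V : BV][BV : BP], where BV/BP is V/P by injectivity of [B]. Each [x] is
    written as a representative modulo BV plus [B *m q x], and [q x] is then classified modulo
    [P]. *)
Lemma class_number_mulmx (n : nat) (B : 'M[int]_n) (P : set 'cV[int]_n) k :
  \det B != 0 -> class_number (fun x y => P (x - y)) k ->
  class_number (fun x y => (mulmx B @` P) (x - y)) (`|\det B| * k).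
Proof.
move=> B0 [g /choice[sP sPK] g_ker].
have [f /choice[s sK] f_ker] := class_number_smith B0.
have /choice[q qE] x : exists q, x = s (f x) + B *m q.
  have /f_ker [q _ qE] : f x = f (s (f x)) by rewrite sK.
  by exists q; rewrite qE addrC subrK.
rewrite -[k]card_ord -[X in (X * _)%N]card_ord -card_prod.
apply: (@class_number_fintype _ _ _ (fun x => (f x, g (q x)))).
  move=> [i j]; exists (s i + B *m (sP j)).
  have fi : f (s i + B *m sP j) = i.
    by rewrite -[RHS]sK; apply/f_ker; exists (sP j); rewrite // addrAC subrr add0r.
  congr (_, _) => //; rewrite -[RHS]sPK; congr g.
  apply: (det_mulmx_inj B0); apply: (@addrI _ (s i)).
  by rewrite -{1}fi -qE.
move=> x y; split=> [[fxy /g_ker Pq]|[p Pp pE]].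
  exists (q x - q y) => //; rewrite mulmxBr [in RHS](qE x) [in RHS](qE y) fxy.
  by rewrite opprD addrACA subrr add0r.
have fxy : f x = f y by apply/f_ker; exists p.
congr (_, _) => //; apply/g_ker; suff -> : q x - q y = p by [].
apply: (det_mulmx_inj B0); rewrite pE mulmxBr.
by rewrite [in RHS](qE x) [in RHS](qE y) fxy opprD addrACA subrr add0r.
Qed.

(** * Twisted conjugacy in an arbitrary group *)

Section TwistedConjugacy.
Local Open Scope group_scope.
Variables (G : groupType) (phi : G -> G) (phiM : {morph phi : x y / x * y}).

Lemma morph1 : phi 1 = 1.
Proof. by apply: (mulgI (phi 1)); rewrite -phiM !mulg1. Qed.

Lemma morphV x : phi x^-1 = (phi x)^-1.
Proof. by apply: (mulgI (phi x)); rewrite -phiM !mulgV morph1. Qed.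

Lemma twisted_conj_refl a : twisted_conj phi a a.
Proof. by exists 1; rewrite morph1 mul1g invg1 mulg1. Qed.

Lemma twisted_conj_sym a b : twisted_conj phi a b -> twisted_conj phi b a.
Proof. by move=> [g ->]; exists g^-1; rewrite morphV invgK !mulgA mulVg mul1g mulgVK. Qed.

Lemma twisted_conj_trans a b c :
  twisted_conj phi a b -> twisted_conj phi b c -> twisted_conj phi a c.
Proof. by move=> [g ->] [h ->]; exists (h * g); rewrite phiM invgM !mulgA. Qed.

Lemma reidemeister_class_eq a b :
  reidemeister_class phi a = reidemeister_class phi b <-> twisted_conj phi a b.
Proof.
split=> [/seteqP[_ /(_ b)]|ab]; first by apply; apply: twisted_conj_refl.
apply/seteqP; split=> c; apply: twisted_conj_trans => //.
exact: twisted_conj_sym.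
Qed.

Lemma U_phi1 : U_phi phi 1.
Proof. by move=> g; rewrite mulg1; apply: twisted_conj_refl. Qed.

Lemma U_phiM x y : U_phi phi x -> U_phi phi y -> U_phi phi (x * y).
Proof. by move=> Ux Uy g; rewrite mulgA; apply: twisted_conj_trans (Ux g) (Uy _). Qed.

Lemma U_phiV x : U_phi phi x -> U_phi phi x^-1.
Proof.
by move=> Ux g; apply: twisted_conj_sym; rewrite -[X in _ X](mulgVK x g).
Qed.

(* Twisting g phi(n) by n gives n g = g (g^-1 n g), and g^-1 n g is in U_phi. *)
Lemma U_phi_stable : normal_subgroup (U_phi phi) -> phi @` U_phi phi `<=` U_phi phi.
Proof.
move=> nU _ [n Un <-] g; have Un' := normalJ nU g^-1 Un; rewrite invgK in Un'.
apply: twisted_conj_trans (Un' g) (twisted_conj_sym _).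
by exists n; rewrite !mulgA mulgV mul1g mulgK.
Qed.

End TwistedConjugacy.

(** * Quotients, separation and the largest resolving kernel *)

Section ResolvingKernels.
Local Open Scope group_scope.
Variable G : groupType.

Lemma lcoset_eq (N : set G) (g h : G) : normal_subgroup N ->
  [set g * n | n in N] = [set h * n | n in N] <-> N (g^-1 * h).
Proof.
move=> nN; split=> [/seteqP[_ /(_ h)]|ghN].
  case; first by exists 1; rewrite ?mulg1 //; apply: normal1.
  by move=> n Nn <-; rewrite mulKg.
apply/seteqP; split=> _ [n Nn <-].
  exists (h^-1 * g * n); last by rewrite -!mulgA mulVKg.
  by apply: normalM => //; have := normalV nN ghN; rewrite invgM invgK.
exists (g^-1 * h * n); last by rewrite -!mulgA mulVKg.
exact: normalM.
Qed.

Lemma group_index_le (N M : set G) :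
  normal_subgroup N -> normal_subgroup M -> N `<=` M ->
  finite_set (lcosets N) -> (group_index M <= group_index N)%N.
Proof.
move=> nN nM NM finN; rewrite /group_index /cardinal.
(* [F] sends a coset [c] to the product cM, so it maps the cosets of [N] onto those of [M]. *)
pose F (c : set G) := [set x | exists2 y, c y & M (y^-1 * x)].
have -> : lcosets M = F @` lcosets N.
  have FE g : F [set g * n | n in N] = [set g * n | n in M].
    apply/seteqP; split=> [x [_ [n /NM Mn <-] Mx]|_ [n Mn <-]].
      exists (n * (n^-1 * g^-1 * x)); last by rewrite !mulgA mulgK mulgV mul1g.
      by apply: normalM => //; rewrite -invgM.
    exists g; last by rewrite mulKg.
    by exists 1; rewrite ?mulg1 //; apply: normal1.
  apply/seteqP; split=> [_ [g _ <-]|_ [_ [g _ <-] <-]].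
    by exists [set g * n | n in N]; [exists g | rewrite FE].
  by rewrite FE; exists g.
rewrite fset_set_image //; exact: finmap.leq_imfset_card.
Qed.

Variables (phi : G -> G) (phiM : {morph phi : x y / x * y}).

Lemma induced_morph (N : set G) (nN : normal_subgroup N) : phi @` N `<=` N ->
  {morph induced nN phi : x y / x * y}.
Proof.
move=> phiN x y.
have [a ->] : exists a, x = quo nN a by exists (repr x); rewrite quo_repr.
have [b ->] : exists b, y = quo nN b by exists (repr y); rewrite quo_repr.
have quoMg c d : quo nN c * quo nN d = quo nN (c * d) by apply: quoM.
by rewrite quoMg !(induced_quo _ phiM phiN) phiM quoMg.
Qed.

(** Lifting the conjugator to [G] leaves an ambiguity in [N], which is collected to the right of
    [b]. *)
Lemma quo_twisted_conj (N : set G) (nN : normal_subgroup N) a b :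
  phi @` N `<=` N ->
  twisted_conj (induced nN phi) (quo nN a) (quo nN b) <->
  exists2 n, N n & twisted_conj phi a (b * n).
Proof.
move=> phiN.
have quoMg x y : quo nN x * quo nN y = quo nN (x * y) by apply: quoM.
(* [quoMg] is instantiated below because the product of two [quo] terms unfolds
   to a [quo] term, so that a bare rewrite would match the whole product. *)
have quoVg x : (quo nN x)^-1 = quo nN x^-1 by apply: quoV.
split=> [[x]|[n Nn [g abE]]].
  have [g ->] : exists g, x = quo nN g by exists (repr x); rewrite quo_repr.
  rewrite (induced_quo _ phiM phiN) quoVg (quoMg g a) (quoMg (g * a)) => /quo_eq Nn.
  by eexists; [exact: Nn | exists g; rewrite mulVKg].
exists (quo nN g); rewrite (induced_quo _ phiM phiN) quoVg.
rewrite (quoMg g a) (quoMg (g * a)) -abE.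
by apply/quo_eq; rewrite mulKg.
Qed.

Lemma quo_R_class_eq (N : set G) (nN : normal_subgroup N) a b :
  phi @` N `<=` N ->
  quo_R nN phi (reidemeister_class phi a) = quo_R nN phi (reidemeister_class phi b)
  <-> exists2 n, N n & twisted_conj phi a (b * n).
Proof.
move=> phiN; rewrite !quo_R_class // reidemeister_class_eq ?quo_twisted_conj //.
exact: induced_morph.
Qed.

(** If the classes of [a] and [b] merge in the quotient, then [a] is twisted conjugate to [b * n]
    with [n] in [U_phi], and [b * n] to [b] by the definition of [U_phi]. *)
Lemma U_phi_separates (nU : normal_subgroup (U_phi phi)) : separates phi nU.
Proof.
move=> _ _ /set_mem[a _ <-] /set_mem[b _ <-].
move=> /quo_R_class_eq []; first exact: U_phi_stable.
move=> n Un ab; apply/reidemeister_class_eq => //.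
by apply: twisted_conj_trans ab (twisted_conj_sym _ (Un b)).
Qed.

Lemma resolving_kernel_sub_U_phi (N : set G) :
  compatible_resolving_kernel phi N -> N `<=` U_phi phi.
Proof.
move=> [nN [_ phiN sepN]] n Nn g; apply/reidemeister_class_eq => //.
apply: sepN; [by rewrite inE; exists g| by rewrite inE; exists (g * n) |].
apply/quo_R_class_eq => //; exists n^-1; first exact: normalV.
by rewrite mulgK; apply: twisted_conj_refl.
Qed.

Lemma U_phi_resolving : normal_subgroup (U_phi phi) ->
  finite_set (lcosets (U_phi phi)) -> compatible_resolving_kernel phi (U_phi phi).
Proof.
move=> nU finU; exists nU; split=> //; first exact: U_phi_stable.
exact: U_phi_separates.
Qed.

Lemma oc_R_U_phi : compatible_resolving_kernel phi (U_phi phi) ->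
  oc_R phi = group_index (U_phi phi).
Proof.
move=> resU; have minU N : compatible_resolving_kernel phi N ->
    (group_index (U_phi phi) <= group_index N)%N.
  move=> resN; have [nN [finN _ _]] := resN; have [nU _] := resU.
  by apply: group_index_le => //; apply: resolving_kernel_sub_U_phi.
(* A minimum is unique, so the choice made by [xget] is forced and its default 0 does not arise. *)
apply: xget_unique => [|k [[N resN <-] minN]]; first by split=> //; exists (U_phi phi).
by apply/eqP; rewrite eqn_leq minN // minU.
Qed.

End ResolvingKernels.

(** * The lattice DZ *)

Section Lattices.
Variable (m : nat) (D : 'M[int]_m).

Lemma image_lattice0 : image_lattice D 0.
Proof. by exists 0; rewrite // mulmx0. Qed.

Lemma image_latticeD u v :
  image_lattice D u -> image_lattice D v -> image_lattice D (u + v).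
Proof. by move=> [x _ <-] [y _ <-]; exists (x + y); rewrite // mulmxDr. Qed.

Lemma image_latticeN u : image_lattice D u -> image_lattice D (- u).
Proof. by move=> [x _ <-]; exists (- x); rewrite // mulmxN. Qed.

Lemma image_latticeB u v :
  image_lattice D u -> image_lattice D v -> image_lattice D (u - v).
Proof. by move=> Du Dv; apply: image_latticeD (image_latticeN _). Qed.

Lemma image_lattice_congr u v :
  image_lattice D (u - v) -> image_lattice D u <-> image_lattice D v.
Proof.
move=> Duv; split=> [Du|Dv]; last by rewrite -(subrK v u); apply: image_latticeD.
by rewrite -(subKr u v); apply: image_latticeB.
Qed.

Lemma image_lattice_mulmx u : image_lattice D (D *m u).
Proof. by exists u. Qed.

End Lattices.

(** * Twisted conjugacy in the group on V x Z, and the identification of [U_phi] *)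

Section HeisenbergTwisted.
Variables (n m : nat).
Notation V := 'cV[int]_n.
Notation Z := 'cV[int]_m.
Variables (beta : {bilinear V -> V -> Z}) (A : 'M[int]_n) (C : 'M[int]_m).
Variable lambda : V -> Z.
Hypothesis lambdaD : forall x y : V, lambda (x + y) - lambda x - lambda y =
  beta (A *m x) (A *m y) - C *m beta x y.
Hypotheses (detB : \det (1%:M - A) != 0) (detD : \det (1%:M - C) != 0).

Notation B := (1%:M - A).
Notation D := (1%:M - C).
Notation phi := (Gamma_map (beta := beta) A C lambda).
Notation omega := (omega beta).
Notation RD := (R_D beta D).
Notation K := (K_phi beta A C lambda).

Let col_addE k (u v : 'cV[int]_k) i : (u + v) i ord0 = u i ord0 + v i ord0.
Proof. by rewrite mxE. Qed.

Let col_oppE k (u : 'cV[int]_k) i : (- u) i ord0 = - u i ord0.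
Proof. by rewrite mxE. Qed.

Let col_0E k i : (0 : 'cV[int]_k) i ord0 = 0.
Proof. by rewrite mxE. Qed.

(** Proves additive identities between column vectors coordinatewise, treating values of [beta] and
    [lambda] as atoms. *)
Local Ltac zmod := apply/colP => ?; rewrite ?(col_addE, col_oppE, col_0E); ring.

Lemma Gamma_mulE x z y w :
  (((x, z) : Gamma beta) * (y, w))%g = (x + y, z + w + beta x y) :> Gamma beta.
Proof. by []. Qed.

Lemma Gamma_invE x z : ((x, z) : Gamma beta)^-1%g = (- x, beta x x - z).
Proof. by []. Qed.

Lemma mulB (x : V) : B *m x = x - A *m x.
Proof. by rewrite mulmxBl mul1mx. Qed.

Lemma mulD (z : Z) : D *m z = z - C *m z.
Proof. by rewrite mulmxBl mul1mx. Qed.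

Lemma lambda_add x y :
  lambda (x + y) = lambda x + lambda y + beta (A *m x) (A *m y) - C *m beta x y.
Proof. have /(canRL (subrK _))/(canRL (subrK _)) -> := lambdaD x y; zmod. Qed.

Lemma lambda0 : lambda 0 = 0.
Proof.
have := lambdaD 0 0; rewrite addr0 !mulmx0 !linear0l mulmx0 subrr subr0 sub0r.
by move=> /eqP; rewrite oppr_eq0 => /eqP.
Qed.

Lemma Gamma_map_morph : {morph phi : g h / (g * h)%g}.
Proof.
move=> [x z] [y w]; rewrite Gamma_mulE /Gamma_map /= Gamma_mulE lambda_add.
by congr (_, _); rewrite ?mulmxDr //; zmod.
Qed.

(** For a conjugator [(x, u)], the coordinate [u] enters only through u - Cu = [D *m u]; letting it
    vary gives the congruence modulo DZ. Multiplying by [phi (x, u)] on the right avoids expanding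
    its inverse. *)
Lemma twisted_conjE y w y' w' :
  twisted_conj phi ((y, w) : Gamma beta) (y', w') <->
  exists2 x, y' - y = B *m x &
    image_lattice D (w' - w - (beta x y - lambda x - beta y' (A *m x))).
Proof.
split=> [[[x u]]|[x yE [u _ uE]]].
  move=> /(congr1 (fun g : Gamma beta => g * phi (x, u))%g).
  rewrite mulgVK !Gamma_mulE /= => -[yE wE]; exists x.
    by rewrite mulB -(addrK (A *m x) y') yE; zmod.
  exists u => //; rewrite mulD.
  have -> : w' = u + w + beta x y - (C *m u + lambda x) - beta y' (A *m x).
    by rewrite -wE; zmod.
  by zmod.
exists (x, u); apply: (mulIg (phi (x, u))); rewrite mulgVK !Gamma_mulE /=; congr (_, _).
  by rewrite -(subrK y y') yE mulB; zmod.
have -> : w' = D *m u + w + (beta x y - lambda x - beta y' (A *m x)) by rewrite uE; zmod.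
by rewrite mulD; zmod.
Qed.

Lemma K_phiE q e : K (q, e) <->
  exists p, [/\ RD p, image_lattice D (e + lambda p + beta (B *m p) (A *m p))
    & q = B *m p].
Proof.
split=> [[p [e' [Rp De [qE eE]]]]|[p [Rp De ->]]]; first by exists p; rewrite eE.
by exists p, e.
Qed.

Lemma mulB_inj x y : B *m x = B *m y -> x = y :> V.
Proof. exact: det_mulmx_inj. Qed.

Lemma K_phi_U_phi : K = U_phi phi.
Proof.
(* The condition of [twisted_conjE] for passing from [(y, w)] to [(y, w) * (q, e)]: the dependence
   on [y] reduces to [omega y p]. *)
have key y w q e p : q = B *m p ->
    w + e + beta y q - w - (beta p y - lambda p - beta (y + q) (A *m p)) =
    e + lambda p + beta (B *m p) (A *m p) + omega y p.
  move=> ->; rewrite /omega linearDl [X in beta y X]mulB linearBr; zmod.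
apply/seteqP; split=> [[q e] /K_phiE [p [Rp De qE]] [y w]|[q e] U].
  rewrite Gamma_mulE; apply/twisted_conjE; exists p; first by rewrite -qE; zmod.
  by rewrite (key _ _ _ _ _ qE); apply: image_latticeD De (Rp y).
have {}U y : exists2 p, q = B *m p &
    image_lattice D (e + lambda p + beta (B *m p) (A *m p) + omega y p).
  have := U (y, 0); rewrite Gamma_mulE => /twisted_conjE [p pE Dp].
  have qE : q = B *m p by rewrite -pE; zmod.
  by exists p; rewrite // -(key y 0 _ _ _ qE).
(* At y = 0 the [omega] term vanishes, leaving the congruence that defines [K_phi]. *)
have [p qE De] := U 0.
have {}De : image_lattice D (e + lambda p + beta (B *m p) (A *m p)).
  by rewrite /omega linear0l linear0r subrr addr0 in De.
apply/K_phiE; exists p; split=> // y; have [p' pE Dy] := U y.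
(* Injectivity of [B] gives the same [p] for every [y], so subtracting the congruence at 0 isolates
   [omega y p]. *)
have pp : p' = p by apply: mulB_inj; rewrite -pE.
rewrite pp in Dy; set c := e + _ + _ in De Dy.
rewrite -[X in image_lattice _ X](addrK c).
by rewrite [omega _ _ + _]addrC; apply: image_latticeB.
Qed.

(** * The form [omega] modulo DZ and its radical [R_D] *)

Lemma omegaBl x y p : omega (x - y) p = omega x p - omega y p.
Proof. rewrite /omega linearBl linearBr; zmod. Qed.

Lemma omegaBr x p q : omega x (p - q) = omega x p - omega x q.
Proof. rewrite /omega linearBl linearBr; zmod. Qed.

Lemma omegaC x y : omega x y = - omega y x.
Proof. by rewrite /omega opprB. Qed.

Lemma R_D0 : RD 0.
Proof. by move=> x; rewrite /omega linear0l linear0r subrr; apply: image_lattice0. Qed.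

Lemma R_DB p q : RD p -> RD q -> RD (p - q).
Proof. by move=> Rp Rq x; rewrite omegaBr; apply: image_latticeB. Qed.

Lemma R_DN p : RD p -> RD (- p).
Proof. by move=> Rp; rewrite -[- p]sub0r; exact: (R_DB R_D0 Rp). Qed.

Lemma R_DD p q : RD p -> RD q -> RD (p + q).
Proof.
move=> Rp Rq; have -> : p + q = p - - q by rewrite opprK.
exact: (R_DB Rp (R_DN Rq)).
Qed.

(** By the adjugate, [\det D] times Z lies in DZ, so [R_D] contains [\det D] times V, which has
    finite index. *)
Lemma class_number_R_D : exists k, class_number (fun x y => RD (x - y)) k.
Proof.
pose M : 'M[int]_n := (\det D)%:M.
have M_neq0 : \det M != 0 by rewrite det_scalar expf_neq0.
apply: (class_number_coarsen _ _ _ _ (class_number_smith M_neq0)) => [x|x y|x y z|x y].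
- by rewrite subrr; apply: R_D0.
- by move/R_DN; rewrite opprB.
- by move=> xy yz; have := R_DD xy yz; rewrite addrA subrK.
move=> [q _ <-] v; rewrite mul_scalar_mx /omega linearZl_LR linearZr_LR -scalerBr.
by rewrite -mul_scalar_mx -mul_mx_adj -mulmxA; apply: image_lattice_mulmx.
Qed.

(** Expanding [lambda (x + y)] and [lambda (y + x)] by [lambda_add] and comparing leaves exactly
    this antisymmetrised identity. *)
Lemma omega_mulA x y : omega (A *m x) (A *m y) = C *m omega x y.
Proof.
have := lambda_add x y; rewrite addrC lambda_add => /eqP.
rewrite -subr_eq0 => /eqP E0; apply/eqP; rewrite -subr_eq0 /omega mulmxBr.
rewrite -oppr_eq0 -[X in _ == X]E0.
by apply/eqP; zmod.
Qed.

(** Since D = I - C, [C] acts as the identity modulo DZ, so by [omega_mulA] each application of [A]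
    preserves [omega] there. *)
Lemma omega_iterA k x y :
  image_lattice D (omega x y - omega (iter k (mulmx A) x) (iter k (mulmx A) y)).
Proof.
elim: k => [|k IHk]; first by rewrite subrr; apply: image_lattice0.
rewrite /= omega_mulA; set w := omega (iter k _ _) _ in IHk *.
have -> : omega x y - C *m w = (omega x y - w) + D *m w by rewrite mulD; zmod.
by apply: image_latticeD IHk (image_lattice_mulmx _ _).
Qed.

(* Modulo DZ, omega is A-invariant, while the orbit of x under A is eventually
   periodic modulo R_D; together they let A be moved to the left argument. *)
Lemma R_D_mulA p : RD p -> RD (A *m p).
Proof.
move=> Rp x; have [k cnR] := class_number_R_D.
have [i [j [ltij Rij]]] := class_number_pigeonhole (fun i => iter i (mulmx A) x) cnR.
apply/(image_lattice_congr (omega_iterA i _ _)); rewrite -iterSr.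
set q := iter i.+1 _ p.
have -> : omega (iter i (mulmx A) x) q = omega (iter j (mulmx A) x) q
   - omega q (iter i (mulmx A) x - iter j (mulmx A) x).
  by rewrite -omegaC omegaBl; zmod.
apply: image_latticeB (Rij _).
(* As j is at least i + 1, both arguments carry i + 1 applications of [A]; removing them leaves [p]
   on the right, where [Rp] applies. *)
rewrite -(subnKC ltij) iterD.
exact/(iffLR (image_lattice_congr (omega_iterA i.+1 _ p)))/Rp.
Qed.

Lemma omega_mulB x p : RD p -> image_lattice D (omega x (B *m p)).
Proof.
move=> Rp; rewrite mulB omegaBr.
exact: image_latticeB (Rp x) (R_D_mulA Rp x).
Qed.

(** * Normality and index of [K_phi], and the number of Reidemeister classes *)

Lemma normal_K_phi : normal_subgroup K.
Proof.
have phiM := Gamma_map_morph.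
split=> [|g h|g|[x z] [q e] /K_phiE [p [Rp De qE]]]; rewrite ?K_phi_U_phi.
- exact: U_phi1.
- exact: U_phiM.
- exact: U_phiV.
rewrite -K_phi_U_phi Gamma_invE !Gamma_mulE; apply/K_phiE; exists p.
split=> //; last by rewrite -qE; zmod.
apply/(iffRL (image_lattice_congr _)): De; rewrite linearDl !linearNr.
(* Here [c] and [f] stand for [beta x q] and [beta q x]: the conjugation changes the congruence by
   [omega x q] alone. *)
have -> : forall a b c d f g h : Z,
  a + b + c + (d - a) + (- d - f) + g + h - (b + g + h) = c - f.
  by move=> *; zmod.
by rewrite qE; apply: omega_mulB.
Qed.

Lemma class_number_K_phi k :
  class_number (fun x y => RD (x - y)) k ->
  class_number (fun g h => K (g^-1 * h)%g) (`|\det B| * k * `|\det D|).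
Proof.
move=> cnR; have nK := normal_K_phi.
apply: class_number_fibered (class_number_mulmx detB cnR)
  (class_number_smith detD) _ _ _ _ _.
- by move=> g h /(normalV nK); rewrite invgM invgK.
- by move=> g h i gh hi; have := normalM nK gh hi; rewrite -mulgA mulVKg.
- move=> x x' [p Rp pE].
  (* The translation makes the expression tested by [K_phi] exactly zero. The sign of [p] changes
     because g^-1 h has first coordinate x' - x, while [pE] describes x - x'. *)
  exists (- lambda (- p) - beta (B *m (- p)) (A *m (- p))
    - beta x x - beta (- x) x') => y.
  rewrite Gamma_invE Gamma_mulE; apply/K_phiE; exists (- p); split; first exact: R_DN.
    set a := lambda _; set b := beta (B *m _) _.
    have -> : forall c d : Z, c - y + (y + (- a - b - c - d)) + d + a + b = 0.
      by move=> *; zmod.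
    exact: image_lattice0.
  by rewrite mulmxN pE; zmod.
- move=> x y x' y'; rewrite Gamma_invE Gamma_mulE => /K_phiE[p [Rp _ pE]].
  by exists (- p); [exact: R_DN | rewrite mulmxN -pE; zmod].
move=> x y y'; rewrite Gamma_invE Gamma_mulE.
have -> : - x + x = 0 by zmod.
have -> : beta x x - y + y' + beta (- x) x = - (y - y') by rewrite linearNl; zmod.
split=> [/K_phiE[p [_ De pE]]|Dy].
  have p0 : p = 0 by apply: mulB_inj; rewrite -pE mulmx0.
  rewrite -[y - y']opprK; apply: image_latticeN.
  by move: De; rewrite p0 lambda0 !mulmx0 linear0l !addr0.
apply/K_phiE; exists 0; split; [exact: R_D0| |by rewrite mulmx0].
by rewrite lambda0 !mulmx0 linear0l !addr0; apply: image_latticeN.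
Qed.

Lemma class_number_twisted_conj :
  class_number (twisted_conj phi) (`|\det B| * `|\det D|).
Proof.
have phiM := Gamma_map_morph.
apply: class_number_fibered (class_number_smith detB) (class_number_smith detD) _ _ _ _ _.
- exact: (twisted_conj_sym phiM).
- exact: (twisted_conj_trans phiM).
- move=> x x' [p _ pE].
  (* This is the value of w' - w for which the congruence of [twisted_conjE] reads 0 modulo DZ. *)
  exists (beta (- p) x - lambda (- p) - beta x' (A *m (- p))) => y.
  apply/twisted_conjE; exists (- p); first by rewrite mulmxN pE opprB.
  by rewrite [y + _]addrC addrK subrr; apply: image_lattice0.
- move=> x y x' y' /twisted_conjE[p pE _].
  by exists (- p); rewrite // mulmxN -pE opprB.
move=> x y y'; split=> [/twisted_conjE[p pE Dp]|Dy].
  (* Within one fibre the conjugator has trivial V-coordinate, so all [beta] and [lambda] terms drop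
     out. *)
  have p0 : p = 0 by apply: mulB_inj; rewrite -pE mulmx0 subrr.
  move: Dp; rewrite p0 lambda0 !mulmx0 linear0l linear0r !subr0.
  by move/image_latticeN; rewrite opprB.
apply/twisted_conjE; exists 0; first by rewrite mulmx0 subrr.
rewrite lambda0 !mulmx0 linear0l linear0r !subr0.
by rewrite -[y' - y]opprB; apply: image_latticeN.
Qed.

Lemma class_number_lattice_index k :
  class_number (fun x y => RD (x - y)) k -> lattice_index RD = k.
Proof.
move=> cnR; apply: (proj2 (cardinal_range cnR _)) => x y.
split=> [/seteqP[/(_ x) xin _]|Rxy].
  have [|p Rp <-] := xin; first by exists 0; [exact: R_D0 | rewrite addr0].
  by rewrite addrAC subrr add0r.
apply/seteqP; split=> _ [p Rp <-].
  by exists (x - y + p); [exact: R_DD | zmod].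
by exists (p - (x - y)); [exact: R_DB | zmod].
Qed.

End HeisenbergTwisted.

(** * Assembly of the kernel, its index and the class count *)

Theorem theorem9p4 (n m : nat)
    (beta : {bilinear 'cV[int]_n -> 'cV[int]_n -> 'cV[int]_m})
    (A : 'M[int]_n) (C : 'M[int]_m) (lambda : 'cV[int]_n -> 'cV[int]_m)
    (lambdaD : forall x y : 'cV[int]_n,
      lambda (x + y) - lambda x - lambda y =
      beta (A *m x) (A *m y) - C *m beta x y)
    (detB : \det (1%:M - A) != 0) (detD : \det (1%:M - C) != 0) :
  let phi : Gamma beta -> Gamma beta := Gamma_map A C lambda in
  let K : set (Gamma beta) := K_phi beta A C lambda in
  let RD : set 'cV[int]_n := R_D beta (1%:M - C) in
  {morph phi : g h / (g * h)%g} /\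
  K = U_phi phi /\
  normal_subgroup K /\
  finite_set (lcosets K) /\
  phi @` K `<=` K /\
  (exists nK : normal_subgroup K, separates phi nK) /\
  (forall N : set (Gamma beta),
     compatible_resolving_kernel phi N -> N `<=` K) /\
  (maximal_resolving_kernel phi K /\
   forall M : set (Gamma beta), maximal_resolving_kernel phi M -> M = K) /\
  oc_R phi =
    (`|\det (1%:M - A)| * `|\det (1%:M - C)| * lattice_index RD)%N /\
  finite_set (reidemeister_set phi) /\
  reidemeister_number phi =
    (`|\det (1%:M - A)| * `|\det (1%:M - C)|)%N /\
  (oc_R phi)%:R / (reidemeister_number phi)%:R =
    (lattice_index RD)%:R :> rat.
Proof.
move=> phi K RD.
have phiM : {morph phi : g h / (g * h)%g} by apply: Gamma_map_morph.
have KU : K = U_phi phi by apply: K_phi_U_phi.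
have nK : normal_subgroup K by apply: normal_K_phi.
have [k cnR] : exists k, class_number (fun x y => RD (x - y)) k.
  exact: class_number_R_D.
have indexR : lattice_index RD = k by apply: class_number_lattice_index.
have [finK indexK] : finite_set (lcosets K) /\
    group_index K = (`|\det (1%:M - A)| * k * `|\det (1%:M - C)|)%N.
  apply: cardinal_range => [|g h]; last exact: lcoset_eq.
  exact: class_number_K_phi.
have [finR numR] : finite_set (reidemeister_set phi) /\
    reidemeister_number phi = (`|\det (1%:M - A)| * `|\det (1%:M - C)|)%N.
  apply: cardinal_range => [|g h]; last exact: reidemeister_class_eq.
  exact: class_number_twisted_conj.
have resK : compatible_resolving_kernel phi K.
  by rewrite KU; apply: U_phi_resolving; rewrite -?KU.
have subK N : compatible_resolving_kernel phi N -> N `<=` K.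
  by rewrite KU; apply: resolving_kernel_sub_U_phi.
have ocK : oc_R phi = (`|\det (1%:M - A)| * `|\det (1%:M - C)| * k)%N.
  by rewrite oc_R_U_phi -?KU // indexK mulnAC.
have [nK' [_ phiK sepK]] := resK.
rewrite indexR; do 6?split=> //; first by exists nK'.
split=> //; split; last do 3?split=> //.
(* A maximal kernel [M] lies in the resolving kernel [K], so its maximality forces equality. *)
- split=> [|M [resM maxM]]; last by rewrite (maxM K) //; apply: subK.
  by split=> // N resN KN; apply/seteqP; split=> //; apply: subK.
(* Both determinants are nonzero, so the Reidemeister number cancels in the rationals. *)
rewrite ocK numR natrM mulrAC mulfV ?mul1r // Num.Theory.pnatr_eq0 muln_eq0.
by rewrite !absz_eq0 negb_or detB.
Qed.
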